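(* Let $(A,\mu_A)$ and $(B,\mu_B)$ be two totally associative $3$-ary algebras over $\mathcal{K}$. Suppose there are linear maps $L_A:A\otimes A\otimes B\to B$, $R_A:B\otimes A\otimes A\to B$, $M_A:A\otimes B\otimes A\to B$ and $L_B:B\otimes B\otimes A\to A$, $R_B:A\otimes B\otimes B\to A$, $M_B:B\otimes A\otimes B\to A$ such that $(L_A,M_A,R_A,B)$ is a quasi trimodule of $(A,\mu_A)$, $(L_B,M_B,R_B,A)$ is a quasi trimodule of $(B,\mu_B)$, and for all $x,y,z\in A$, $a,b,c\in B$: 1. $\mu_A(L_B(a,b)(x),y,z)=L_B(a,R_A(x,y)(b))(z)=L_B(a,b)(\mu_A(x,y,z))$, 2. $\mu_A(M_B(a,b)(x),y,z)=L_B(a,M_A(x,y)(b))(z)=M_B(a,R_A(y,z)(b))(x)$, 3. $\mu_A(R_B(a,b)(x),y,z)=\mu_A(x,L_B(a,b)(y),z)=R_B(a,R_A(y,z)(b))(x)$, 4. $L_B(L_A(x,y)(a),b)(z)=\mu_A(x,R_B(a,b)(y),z)=\mu_A(x,y,L_B(a,b)(z))$, 5. $L_B(M_A(x,y)(a),b)(z)=\mu_A(x,M_B(a,b)(y),z)=R_B(a,M_A(y,z)(b))(x)$, 6. $L_B(R_A(x,y)(a),b)(z)=L_B(a,L_A(x,y)(b))(z)=M_B(a,M_A(y,z)(b))(x)$, 7. $M_B(L_A(x,y)(a),b)(z)=R_B(M_A(y,z)(a),b)(x)=\mu_A(x,y,M_B(a,b)(z))$, 8. $M_B(M_A(x,y)(a),b)(z)=R_B(R_A(y,z)(a),b)(x)=R_B(a,L_A(y,z)(b))(x)$,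 9. $M_B(R_A(x,y)(a),b)(z)=M_B(a,b)(\mu_A(x,y,z))=M_B(a,L_A(y,z)(b))(x)$, 10. $R_B(a,b)(\mu_A(x,y,z))=R_B(L_A(y,z)(a),b)(x)=\mu_A(x,y,R_B(a,b)(z))$, 11. $\mu_B(L_A(x,y)(a),b,c)=L_A(x,R_B(a,b)(y))(c)=L_A(x,y)(\mu_B(a,b,c))$, 12. $\mu_B(M_A(x,y)(a),b,c)=L_A(x,M_B(a,b)(y))(c)=M_A(x,R_B(b,c)(y))(a)$, 13. $\mu_B(R_A(x,y)(a),b,c)=\mu_B(a,L_A(x,y)(b),c)=R_A(x,R_B(b,c)(y))(a)$, 14. $L_A(L_B(a,b)(x),y)(c)=\mu_B(a,R_A(x,y)(b),c)=\mu_B(a,b,L_A(x,y)(c))$, 15. $L_A(M_B(a,b)(x),y)(c)=\mu_B(a,M_A(x,y)(b),c)=R_A(x,M_B(b,c)(y))(a)$, 16. $L_A(R_B(a,b)(x),y)(c)=L_A(x,L_B(a,b)(y))(c)=M_A(x,M_B(b,c)(y))(a)$, 17. $M_A(L_B(a,b)(x),y)(c)=R_A(M_B(b,c)(x),y)(a)=\mu_B(a,b,M_A(x,y)(c))$, 18. $M_A(M_B(a,b)(x),y)(c)=R_A(R_B(b,c)(x),y)(a)=R_A(x,L_B(b,c)(y))(a)$, 19. $M_A(R_B(a,b)(x),y)(c)=M_A(x,y)(\mu_B(a,b,c))=M_A(x,L_B(b,c)(y))(a)$, 20. $R_A(x,y)(\mu_B(a,b,c))=R_A(L_B(b,c)(x),y)(a)=\mu_B(a,b,R_A(x,y)(c))$.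 Then the direct sum $A\oplus B$ is a totally associative $3$-ary algebra under the product $$\begin{aligned}\tau[(x+a),(y+b),(z+c)]=&\,[\mu_A(x,y,z)+L_B(a,b)(z)+M_B(a,c)(y)+R_B(b,c)(x)]\\&+[\mu_B(a,b,c)+L_A(x,y)(c)+M_A(x,z)(b)+R_A(y,z)(a)],\end{aligned}$$ for $x,y,z\in A$, $a,b,c\in B$.
   Context: $\mathcal{K}$ is a fixed field of characteristic zero. A totally associative $3$-ary algebra is a $\mathcal{K}$-vector space $A$ with a trilinear operation $\mu$ satisfying $\mu(\mu(x_1,x_2,x_3),x_4,x_5)=\mu(x_1,\mu(x_2,x_3,x_4),x_5)=\mu(x_1,x_2,\mu(x_3,x_4,x_5))$ for all $x_i\in A$. For linear maps $L:A\otimes A\otimes V\to V$, $M:A\otimes V\otimes A\to V$, $R:V\otimes A\otimes A\to V$ one writes $L(x,y)(v)$, $M(x,y)(v)$, $R(x,y)(v)$ for the values at $x\otimes y\otimes v$, $x\otimes v\otimes y$, $v\otimes x\otimes y$. $(L,M,R,V)$ is a quasi trimodule of the totally associative $3$-ary algebra $(A,\mu)$ if for all $a,b,c,d\in A$, $v\in V$: $L(a,b)(L(c,d)(v))=L(\mu(a,b,c),d)(v)=L(a,\mu(b,c,d))(v)$; $R(c,d)(R(a,b)(v))=R(a,\mu(b,c,d))(v)=R(\mu(a,b,c),d)(v)$; $M(a,d)(L(b,c)(v))=L(a,b)(M(c,d)(v))=M(\mu(a,b,c),d)(v)$; $M(a,d)(R(b,c)(v))=R(c,d)(M(a,b)(v))=M(a,\mu(b,c,d))(v)$;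 $R(c,d)(L(a,b)(v))=L(a,b)(R(c,d)(v))=M(a,d)(M(b,c)(v))$. (A trimodule additionally satisfies $M(a,z)(M(b,y)(M(c,x)(v)))=M(\mu(a,b,c),\mu(x,y,z))(v)$; for a quasi trimodule this is not required.) *)

(* Defs.v *)
From HB Require Import structures.
From mathcomp Require Import all_boot all_order all_algebra.

Set Implicit Arguments.
Unset Strict Implicit.
Unset Printing Implicit Defensive.

Import GRing.Theory.
Local Open Scope ring_scope.

(* Linear maps out of U (x) V (x) W are given in curried form. *)
Record trilinear (K : fieldType) (U V W X : lmodType K)
    (f : U -> V -> W -> X) : Prop := Trilinear {
  trilinear1 : forall v w, linear (fun u => f u v w);
  trilinear2 : forall u w, linear (fun v => f u v w);
  trilinear3 : forall u v, linear (fun w => f u v w)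
}.

Record totally_associative (K : fieldType) (A : lmodType K)
    (mu : A -> A -> A -> A) : Prop := TotallyAssociative {
  ta_trilinear : trilinear mu;
  ta_assocl : forall x1 x2 x3 x4 x5,
    mu (mu x1 x2 x3) x4 x5 = mu x1 (mu x2 x3 x4) x5;
  ta_assocr : forall x1 x2 x3 x4 x5,
    mu x1 (mu x2 x3 x4) x5 = mu x1 x2 (mu x3 x4 x5)
}.

(* All three actions take the module element last: [L x y v], [M x y v] and
   [R x y v] are the values L(x,y)(v), M(x,y)(v) and R(x,y)(v) of
   L : A (x) A (x) V -> V at x (x) y (x) v, of M : A (x) V (x) A -> V at
   x (x) v (x) y, and of R : V (x) A (x) A -> V at v (x) x (x) y.
   Being trilinear does not depend on the order of the arguments. *)
Record quasi_trimodule (K : fieldType) (A V : lmodType K)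
    (mu : A -> A -> A -> A) (L M R : A -> A -> V -> V) : Prop :=
  QuasiTrimodule {
  qt_trilinearL : trilinear L;
  qt_trilinearM : trilinear M;
  qt_trilinearR : trilinear R;
  qt_LL : forall a b c d v,
    L a b (L c d v) = L (mu a b c) d v /\
    L (mu a b c) d v = L a (mu b c d) v;
  qt_RR : forall a b c d v,
    R c d (R a b v) = R a (mu b c d) v /\
    R a (mu b c d) v = R (mu a b c) d v;
  qt_ML : forall a b c d v,
    M a d (L b c v) = L a b (M c d v) /\
    L a b (M c d v) = M (mu a b c) d v;
  qt_MR : forall a b c d v,
    M a d (R b c v) = R c d (M a b v) /\
    R c d (M a b v) = M a (mu b c d) v;
  qt_RL : forall a b c d v,
    R c d (L a b v) = L a b (R c d v) /\
    L a b (R c d v) = M a d (M b c v)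
}.

Definition dsum_op (K : fieldType) (A B : lmodType K)
    (muA : A -> A -> A -> A) (muB : B -> B -> B -> B)
    (LA MA RA : A -> A -> B -> B) (LB MB RB : B -> B -> A -> A)
    (u v w : A * B) : A * B :=
  let: (x, a) := u in let: (y, b) := v in let: (z, c) := w in
  (muA x y z + LB a b z + MB a c y + RB b c x,
   muB a b c + LA x y c + MA x z b + RA y z a).

(* Main.v *)
Require Import Defs.
From HB Require Import structures.
From mathcomp Require Import all_boot all_order all_algebra.

Set Implicit Arguments.
Unset Strict Implicit.
Unset Printing Implicit Defensive.

Import GRing.Theory.
Local Open Scope ring_scope.

(* Exchanging the roles of A and B gives the B-component of the product. *)
Definition dsum_fst (K : fieldType) (A B : lmodType K)
    (muA : A -> A -> A -> A) (LB MB RB : B -> B -> A -> A)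
    (x y z : A) (a b c : B) : A :=
  muA x y z + LB a b z + MB a c y + RB b c x.

(** Scalar 1 in the linearity condition leaves plain additivity. This form and its analogues for the
    other two slots serve as rewrite rules for expanding nested products. *)
Lemma trilinearD1 (K : fieldType) (U V W X : lmodType K)
    (f : U -> V -> W -> X) : trilinear f ->
  forall u u' v w, f (u + u') v w = f u v w + f u' v w.
Proof.
by move=> tf u u' v w; have /= := trilinear1 tf v w 1 u u'; rewrite !scale1r.
Qed.

Lemma trilinearD2 (K : fieldType) (U V W X : lmodType K)
    (f : U -> V -> W -> X) : trilinear f ->
  forall u v v' w, f u (v + v') w = f u v w + f u v' w.
Proof.
by move=> tf u v v' w; have /= := trilinear2 tf u w 1 v v'; rewrite !scale1r.
Qed.

Lemma trilinearD3 (K : fieldType) (U V W X : lmodType K)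
    (f : U -> V -> W -> X) : trilinear f ->
  forall u v w w', f u v (w + w') = f u v w + f u v w'.
Proof.
by move=> tf u v w w'; have /= := trilinear3 tf u v 1 w w'; rewrite !scale1r.
Qed.

Section DsumFstLinear.

Variables (K : fieldType) (A B : lmodType K).
Variables (muA : A -> A -> A -> A) (LB MB RB : B -> B -> A -> A).
Hypotheses (tmu : trilinear muA).
Hypotheses (tL : trilinear LB) (tM : trilinear MB) (tR : trilinear RB).

Let F := dsum_fst muA LB MB RB.

(** Each of the four summands contains exactly one of [x] and [a], and is linear in it; hence the
    sum is linear in the pair, although not in [x] or [a] alone. *)
Lemma dsum_fst_linear1 k x x' a a' y z b c :
  F (k *: x + x') y z (k *: a + a') b c = k *: F x y z a b c + F x' y z a' b c.
Proof.
(* [a] fills the first slot of [LB] and [MB], whereas [x], as the module element, fills the last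
   slot of [RB]. *)
rewrite /F /dsum_fst (trilinear1 tmu) (trilinear1 tL) (trilinear1 tM).
(* Each summand has split in two: odd positions hold the multiples of [k], even positions the primed
   terms. *)
by rewrite (trilinear3 tR) !scalerDr (AC (2*2*2*2) ((1*3*5*7)*(2*4*6*8))).
Qed.

Lemma dsum_fst_linear2 k y y' b b' x z a c :
  F x (k *: y + y') z a (k *: b + b') c = k *: F x y z a b c + F x y' z a b' c.
Proof.
rewrite /F /dsum_fst (trilinear2 tmu) (trilinear2 tL) (trilinear3 tM).
by rewrite (trilinear1 tR) !scalerDr (AC (2*2*2*2) ((1*3*5*7)*(2*4*6*8))).
Qed.

Lemma dsum_fst_linear3 k z z' c c' x y a b :
  F x y (k *: z + z') a b (k *: c + c') = k *: F x y z a b c + F x y z' a b c'.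
Proof.
rewrite /F /dsum_fst (trilinear3 tmu) (trilinear3 tL) (trilinear2 tM).
by rewrite (trilinear2 tR) !scalerDr (AC (2*2*2*2) ((1*3*5*7)*(2*4*6*8))).
Qed.

End DsumFstLinear.

(* Each condition is associativity on one word of length 5 with exactly two
   letters in B; words with four letters in B are covered by the quasi
   trimodule axioms, and those without B by the associativity of [muA]. *)
Lemma dsum_fst_assoc (K : fieldType) (A B : lmodType K)
    (muA : A -> A -> A -> A) (muB : B -> B -> B -> B)
    (assA : totally_associative muA)
    (LA RA MA : A -> A -> B -> B) (LB RB MB : B -> B -> A -> A)
    (trimodB : quasi_trimodule muB LB MB RB)
    (cond1 : forall (x y z : A) (a b : B),
      muA (LB a b x) y z = LB a (RA x y b) z /\
      LB a (RA x y b) z = LB a b (muA x y z))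
    (cond2 : forall (x y z : A) (a b : B),
      muA (MB a b x) y z = LB a (MA x y b) z /\
      LB a (MA x y b) z = MB a (RA y z b) x)
    (cond3 : forall (x y z : A) (a b : B),
      muA (RB a b x) y z = muA x (LB a b y) z /\
      muA x (LB a b y) z = RB a (RA y z b) x)
    (cond4 : forall (x y z : A) (a b : B),
      LB (LA x y a) b z = muA x (RB a b y) z /\
      muA x (RB a b y) z = muA x y (LB a b z))
    (cond5 : forall (x y z : A) (a b : B),
      LB (MA x y a) b z = muA x (MB a b y) z /\
      muA x (MB a b y) z = RB a (MA y z b) x)
    (cond6 : forall (x y z : A) (a b : B),
      LB (RA x y a) b z = LB a (LA x y b) z /\
      LB a (LA x y b) z = MB a (MA y z b) x)
    (cond7 : forall (x y z : A) (a b : B),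
      MB (LA x y a) b z = RB (MA y z a) b x /\
      RB (MA y z a) b x = muA x y (MB a b z))
    (cond8 : forall (x y z : A) (a b : B),
      MB (MA x y a) b z = RB (RA y z a) b x /\
      RB (RA y z a) b x = RB a (LA y z b) x)
    (cond9 : forall (x y z : A) (a b : B),
      MB (RA x y a) b z = MB a b (muA x y z) /\
      MB a b (muA x y z) = MB a (LA y z b) x)
    (cond10 : forall (x y z : A) (a b : B),
      RB a b (muA x y z) = RB (LA y z a) b x /\
      RB (LA y z a) b x = muA x y (RB a b z))
    (x1 x2 x3 x4 x5 : A) (a1 a2 a3 a4 a5 : B) :
  let F := dsum_fst muA LB MB RB in let G := dsum_fst muB LA MA RA in
  F (F x1 x2 x3 a1 a2 a3) x4 x5 (G a1 a2 a3 x1 x2 x3) a4 a5 =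
    F x1 (F x2 x3 x4 a2 a3 a4) x5 a1 (G a2 a3 a4 x2 x3 x4) a5 /\
  F x1 (F x2 x3 x4 a2 a3 a4) x5 a1 (G a2 a3 a4 x2 x3 x4) a5 =
    F x1 x2 (F x3 x4 x5 a3 a4 a5) a1 a2 (G a3 a4 a5 x3 x4 x5).
Proof.
have [tmu assl assr] := assA; have [tL tM tR LL RR ML MR RL] := trimodB.
rewrite /= /dsum_fst.
(* Each side expands into 16 terms, one for each word of length 5 with an even number of letters in
   [B]: 1 + 10 + 5. *)
rewrite !(trilinearD1 tmu, trilinearD1 tL, trilinearD1 tM, trilinearD1 tR).
rewrite !(trilinearD2 tmu, trilinearD2 tL, trilinearD2 tM, trilinearD2 tR).
rewrite !(trilinearD3 tmu, trilinearD3 tL, trilinearD3 tM, trilinearD3 tR).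
(* The permutations match the summands of the two sides word by word. *)
split.
- rewrite [LHS](AC (4*4*4*4) ((1*4*7*6)*(5*8*3*2)*(12*9*14*15)*(16*13*10*11))).
  (* The blocks of four goals follow the outer operations [muA], [LB], [MB], [RB] of the right-hand
     side. *)
  congr (_ + _ + _ + _); congr (_ + _ + _ + _).
  + exact: assl.
  (* Every condition lists the left, middle and right bracketing of its word in this order, so its
     first equation is what is needed here and its second one in the other half. *)
  + exact: (cond3 _ _ _ _ _).1.
  + exact: (cond5 _ _ _ _ _).1.
  + exact: (cond4 _ _ _ _ _).1.
  + exact: (LL _ _ _ _ _).2.
  + exact: (cond6 _ _ _ _ _).1.
  + exact: (cond2 _ _ _ _ _).1.
  + exact: (cond1 _ _ _ _ _).1.
  + exact: (cond9 _ _ _ _ _).1.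
  (* The quasi trimodule chains list the bracketings in other orders. This one runs middle, right,
     left, so its two ends are joined, read backwards. *)
  + exact: etrans (esym (ML _ _ _ _ _).2) (esym (ML _ _ _ _ _).1).
  + exact: etrans (RL _ _ _ _ _).1 (RL _ _ _ _ _).2.
  + exact: esym (MR _ _ _ _ _).1.
  + exact: etrans (RR _ _ _ _ _).1 (RR _ _ _ _ _).2.
  + exact: (cond10 _ _ _ _ _).1.
  + exact: (cond7 _ _ _ _ _).1.
  + exact: (cond8 _ _ _ _ _).1.
- rewrite [LHS](AC (4*4*4*4) ((1*4*15*14)*(8*5*10*11)*(12*9*6*7)*(13*16*3*2))).
  congr (_ + _ + _ + _); congr (_ + _ + _ + _).
  + exact: assr.
  + exact: (cond4 _ _ _ _ _).2.
  + exact: (cond7 _ _ _ _ _).2.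
  + exact: (cond10 _ _ _ _ _).2.
  + exact: (cond1 _ _ _ _ _).2.
  (* The chain for [L] runs right, left, middle; equating middle with right again means joining its
     ends in reverse. *)
  + exact: esym (etrans (LL _ _ _ _ _).1 (LL _ _ _ _ _).2).
  + exact: (ML _ _ _ _ _).1.
  + exact: esym (RL _ _ _ _ _).2.
  + exact: etrans (MR _ _ _ _ _).1 (MR _ _ _ _ _).2.
  + exact: (cond9 _ _ _ _ _).2.
  + exact: (cond6 _ _ _ _ _).2.
  + exact: (cond2 _ _ _ _ _).2.
  + exact: esym (RR _ _ _ _ _).2.
  + exact: (cond8 _ _ _ _ _).2.
  + exact: (cond5 _ _ _ _ _).2.
  + exact: (cond3 _ _ _ _ _).2.
Qed.

Theorem theorem3p4 (K : fieldType) (charK0 : [pchar K] =i pred0)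
    (A B : lmodType K)
    (muA : A -> A -> A -> A) (muB : B -> B -> B -> B)
    (assA : totally_associative muA) (assB : totally_associative muB)
    (LA RA MA : A -> A -> B -> B) (LB RB MB : B -> B -> A -> A)
    (trimodA : quasi_trimodule muA LA MA RA)
    (trimodB : quasi_trimodule muB LB MB RB)
    (cond1 : forall (x y z : A) (a b : B),
      muA (LB a b x) y z = LB a (RA x y b) z /\
      LB a (RA x y b) z = LB a b (muA x y z))
    (cond2 : forall (x y z : A) (a b : B),
      muA (MB a b x) y z = LB a (MA x y b) z /\
      LB a (MA x y b) z = MB a (RA y z b) x)
    (cond3 : forall (x y z : A) (a b : B),
      muA (RB a b x) y z = muA x (LB a b y) z /\
      muA x (LB a b y) z = RB a (RA y z b) x)
    (cond4 : forall (x y z : A) (a b : B),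
      LB (LA x y a) b z = muA x (RB a b y) z /\
      muA x (RB a b y) z = muA x y (LB a b z))
    (cond5 : forall (x y z : A) (a b : B),
      LB (MA x y a) b z = muA x (MB a b y) z /\
      muA x (MB a b y) z = RB a (MA y z b) x)
    (cond6 : forall (x y z : A) (a b : B),
      LB (RA x y a) b z = LB a (LA x y b) z /\
      LB a (LA x y b) z = MB a (MA y z b) x)
    (cond7 : forall (x y z : A) (a b : B),
      MB (LA x y a) b z = RB (MA y z a) b x /\
      RB (MA y z a) b x = muA x y (MB a b z))
    (cond8 : forall (x y z : A) (a b : B),
      MB (MA x y a) b z = RB (RA y z a) b x /\
      RB (RA y z a) b x = RB a (LA y z b) x)
    (cond9 : forall (x y z : A) (a b : B),
      MB (RA x y a) b z = MB a b (muA x y z) /\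
      MB a b (muA x y z) = MB a (LA y z b) x)
    (cond10 : forall (x y z : A) (a b : B),
      RB a b (muA x y z) = RB (LA y z a) b x /\
      RB (LA y z a) b x = muA x y (RB a b z))
    (cond11 : forall (x y : A) (a b c : B),
      muB (LA x y a) b c = LA x (RB a b y) c /\
      LA x (RB a b y) c = LA x y (muB a b c))
    (cond12 : forall (x y : A) (a b c : B),
      muB (MA x y a) b c = LA x (MB a b y) c /\
      LA x (MB a b y) c = MA x (RB b c y) a)
    (cond13 : forall (x y : A) (a b c : B),
      muB (RA x y a) b c = muB a (LA x y b) c /\
      muB a (LA x y b) c = RA x (RB b c y) a)
    (cond14 : forall (x y : A) (a b c : B),
      LA (LB a b x) y c = muB a (RA x y b) c /\
      muB a (RA x y b) c = muB a b (LA x y c))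
    (cond15 : forall (x y : A) (a b c : B),
      LA (MB a b x) y c = muB a (MA x y b) c /\
      muB a (MA x y b) c = RA x (MB b c y) a)
    (cond16 : forall (x y : A) (a b c : B),
      LA (RB a b x) y c = LA x (LB a b y) c /\
      LA x (LB a b y) c = MA x (MB b c y) a)
    (cond17 : forall (x y : A) (a b c : B),
      MA (LB a b x) y c = RA (MB b c x) y a /\
      RA (MB b c x) y a = muB a b (MA x y c))
    (cond18 : forall (x y : A) (a b c : B),
      MA (MB a b x) y c = RA (RB b c x) y a /\
      RA (RB b c x) y a = RA x (LB b c y) a)
    (cond19 : forall (x y : A) (a b c : B),
      MA (RB a b x) y c = MA x y (muB a b c) /\
      MA x y (muB a b c) = MA x (LB b c y) a)
    (cond20 : forall (x y : A) (a b c : B),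
      RA x y (muB a b c) = RA (LB b c x) y a /\
      RA (LB b c x) y a = muB a b (RA x y c)) :
  totally_associative (dsum_op muA muB LA MA RA LB MB RB).
Proof.
have [tmA _ _] := assA; have [tmB _ _] := assB.
have [tLA tMA tRA _ _ _ _ _] := trimodA; have [tLB tMB tRB _ _ _ _ _] := trimodB.
have assocA := dsum_fst_assoc assA trimodB
  cond1 cond2 cond3 cond4 cond5 cond6 cond7 cond8 cond9 cond10.
(* Conditions 11 to 20 are conditions 1 to 10 with [A] and [B] exchanged; the abstractions only
   reorder the quantified variables. *)
have assocB := dsum_fst_assoc assB trimodA
  (fun x y z a b => cond11 a b x y z) (fun x y z a b => cond12 a b x y z)
  (fun x y z a b => cond13 a b x y z) (fun x y z a b => cond14 a b x y z)
  (fun x y z a b => cond15 a b x y z) (fun x y z a b => cond16 a b x y z)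
  (fun x y z a b => cond17 a b x y z) (fun x y z a b => cond18 a b x y z)
  (fun x y z a b => cond19 a b x y z) (fun x y z a b => cond20 a b x y z).
split.
- split.
  (* One lemma closes both components, the second with [A] and [B] exchanged; its trilinearity
     premises are found in the context. *)
  + move=> [y b] [z c] k [x a] [x' a']; congr pair; exact: dsum_fst_linear1.
  + move=> [x a] [z c] k [y b] [y' b']; congr pair; exact: dsum_fst_linear2.
  + move=> [x a] [y b] k [z c] [z' c']; congr pair; exact: dsum_fst_linear3.
- move=> [x1 a1] [x2 a2] [x3 a3] [x4 a4] [x5 a5]; congr pair.
  + exact: (assocA _ _ _ _ _ _ _ _ _ _).1.
  + exact: (assocB _ _ _ _ _ _ _ _ _ _).1.
- move=> [x1 a1] [x2 a2] [x3 a3] [x4 a4] [x5 a5]; congr pair.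
  + exact: (assocA _ _ _ _ _ _ _ _ _ _).2.
  + exact: (assocB _ _ _ _ _ _ _ _ _ _).2.
Qed.
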